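(* Let $A$ be an alphabet and let $C\subset A^+$ be a code, graded by length, i.e. $C_n=C\cap A^n$ for $n\ge 1$. For every $i\ge 1$ the $C$-Witt symmetric function $Q_i[C]$ is the characteristic series $\underline{\mathsf Q_i}$ of a (possibly empty) code $\mathsf Q_i\subset A^+$, and the sequence obtained by deleting the empty sets from $(\mathsf Q_1,\mathsf Q_2,\dots,\mathsf Q_n,\dots)$ is the right length factorization $\mathcal F(C^* )$ of $C^*$.
   Context: For a set of words $S$, $\underline S=\sum_{w\in S}w$ denotes its characteristic series (a noncommutative formal power series). A code $C\subset A^+$ is a minimal generating set of a free submonoid $C^*$ of the free monoid $A^*$. The empty set is allowed as a code, with characteristic series $0$. Noncommutative symmetric functions: $\mathbf{Sym}=\mathbb Q\langle\Lambda_1,\Lambda_2,\dots\rangle$ is the free associative algebra on generators $\Lambda_n$ of degree $n$ (elementary functions), with $\Lambda_0=1$. The complete functions $S_n$ ($S_0=1$) are defined by $\sigma_t=\sum_{n\ge 0}S_nt^n=\left(\sum_{k\ge 0}(-t)^k\Lambda_k\right)^{-1}$, where $t$ is a central variable. The noncommutative Witt symmetric functions $Q_n\in\mathbf{Sym}$ ($Q_n$ of degree $n$) are defined by $$\frac1{1-tQ_1}\,\frac1{1-t^2Q_2}\,\frac1{1-t^3Q_3}\cdots=\sum_{n\ge 0}t^nS_n ,$$ the product being taken from left to right in increasing order of $n$. Specialization at a code: for a code $C=\coprod_{n\ge1}C_n$ with $C_n=C\cap A^n$, the specialization $F\mapsto F[C]$ is the algebra morphism determined by $\Lambda_n[C]=(-1)^{n-1}\underline{C_n}$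 for $n\ge 1$; equivalently $S_n[C]$ is the sum of all words of length $n$ in $C^*$. The $C$-Witt symmetric function $Q_i[C]$ is the image of $Q_i$ under this specialization. Weight factorizations: let $B$ be an alphabet (possibly infinite) and $\omega:B\to\mathbb N\setminus\{0\}$ a weight function, extended to a monoid morphism $\omega:B^*\to(\mathbb N,+)$. Define sequences of codes $(Z_i)_{i\ge1}$ and $(D_i)_{i\ge1}$ in $B^*$ by $Z_1=B$; $D_i=Z_i\cap\{w\in B^*:\omega(w)=i\}$ for each $i>0$; and $Z_{i+1}=(Z_i\setminus D_i)D_i^*$ for each $i>0$. Then $\mathcal F(B,\omega)$ denotes the sequence obtained from $(D_i)_{i\ge1}$ by omitting the empty sets. For a code $C\subset A^+$, regard $C$ itself as an alphabet (so that $C^*$ is the free monoid on $C$) and let $l$ be the length of words over $A$; the right length factorization of $C^*$ is $\mathcal F(C^* )=\mathcal F(C,l)$. *)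

(* Defs.v *)
From HB Require Import structures.
From mathcomp Require Import all_boot all_order all_algebra.
From mathcomp Require Import boolp classical_sets.
From mathcomp Require Import monalg.

Set Implicit Arguments.
Unset Strict Implicit.
Unset Printing Implicit Defensive.

Import GRing.Theory.

Local Open Scope classical_set_scope.
Local Open Scope ring_scope.

(** [f : fps R] stands for [\sum_n (f n) t^n], where [t] is central and [R] need
    not be commutative. *)

Definition fps (R : nzRingType) : Type := nat -> R.

Section Fps.
Variable R : nzRingType.
Implicit Types (f g h : fps R) (n : nat).

HB.instance Definition _ := gen_eqMixin (fps R).
HB.instance Definition _ := gen_choiceMixin (fps R).

Definition fps_zero : fps R := fun=> 0.
Definition fps_opp f : fps R := fun n => - f n.
Definition fps_add f g : fps R := fun n => f n + g n.
Definition fps_one : fps R := fun n => (n == 0%N)%:R.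
Definition fps_mul f g : fps R := fun n => \sum_(i < n.+1) f i * g (n - i)%N.

Fact fps_addA : associative fps_add.
Proof. by move=> f g h; apply: funext => n; exact: addrA. Qed.
Fact fps_addC : commutative fps_add.
Proof. by move=> f g; apply: funext => n; exact: addrC. Qed.
Fact fps_add0 : left_id fps_zero fps_add.
Proof. by move=> f; apply: funext => n; exact: add0r. Qed.
Fact fps_addN : left_inverse fps_zero fps_opp fps_add.
Proof. by move=> f; apply: funext => n; exact: addNr. Qed.

HB.instance Definition _ :=
  GRing.isZmodule.Build (fps R) fps_addA fps_addC fps_add0 fps_addN.

Let shift f : fps R := fun n => f n.+1.

Let fps_mulS f g n :
  fps_mul f g n.+1 = f 0%N * g n.+1 + fps_mul (shift f) g n.
Proof. by rewrite /fps_mul big_ord_recl subn0. Qed.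

Let fps_mul_0 f g : fps_mul f g 0%N = f 0%N * g 0%N.
Proof. by rewrite /fps_mul big_ord1. Qed.

Let fps_mulDn f g h n :
  fps_mul (fps_add f g) h n = fps_mul f h n + fps_mul g h n.
Proof. by rewrite /fps_mul -big_split; apply: eq_bigr => i _; rewrite mulrDl. Qed.

Let fps_mulZn c f g n :
  fps_mul (fun m => c * f m) g n = c * fps_mul f g n.
Proof. by rewrite /fps_mul mulr_sumr; apply: eq_bigr => i _; rewrite mulrA. Qed.

Fact fps_mulA : associative fps_mul.
Proof.
move=> f g h; apply: funext => n; elim: n f g h => [|n IH] f g h.
  by rewrite !fps_mul_0 mulrA.
rewrite !fps_mulS fps_mul_0 IH mulrDr mulrA -addrA; congr (_ + _).
rewrite -fps_mulZn -fps_mulDn; congr (fps_mul _ _ _).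
by apply: funext => m; rewrite /shift fps_mulS.
Qed.

Fact fps_mul1l : left_id fps_one fps_mul.
Proof.
move=> f; apply: funext => n.
rewrite /fps_mul big_ord_recl subn0 mul1r big1 ?addr0 // => i _.
by rewrite mul0r.
Qed.

Fact fps_mul1r : right_id fps_one fps_mul.
Proof.
move=> f; apply: funext => n.
rewrite /fps_mul big_ord_recr /= subnn mulr1 big1 ?add0r // => i _.
by rewrite /fps_one subn_eq0 leqNgt ltn_ord mulr0.
Qed.

Fact fps_mulDl : left_distributive fps_mul fps_add.
Proof. by move=> f g h; apply: funext => n; exact: fps_mulDn. Qed.

Fact fps_mulDr : right_distributive fps_mul fps_add.
Proof.
move=> f g h; apply: funext => n; rewrite /fps_mul /fps_add -big_split.
by apply: eq_bigr => i _; rewrite mulrDr.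
Qed.

Fact fps_one_neq0 : fps_one != 0.
Proof. by apply/eqP => /(congr1 (@^~ 0%N)) /eqP; rewrite /fps_one oner_eq0. Qed.

HB.instance Definition _ := GRing.Zmodule_isNzRing.Build (fps R)
  fps_mulA fps_mul1l fps_mul1r fps_mulDl fps_mulDr fps_one_neq0.

Definition fps_invertible f g := g * f = 1 /\ f * g = 1.

(** Classical choice of the (unique) two-sided inverse, when there is one. *)
Definition fps_unit : pred (fps R) := fun f => `[< exists g, fps_invertible f g >].

Definition fps_inv f : fps R :=
  if pselect (exists g, fps_invertible f g) is left e then sval (cid e) else f.

Fact fps_inv_unit f : fps_unit f -> fps_invertible f (fps_inv f).
Proof.
by move=> /asboolP uf; rewrite /fps_inv; case: pselect => // e; case: cid.
Qed.

Fact fps_mulVr : {in fps_unit, left_inverse 1 fps_inv *%R}.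
Proof. by move=> f /fps_inv_unit []. Qed.
Fact fps_mulrV : {in fps_unit, right_inverse 1 fps_inv *%R}.
Proof. by move=> f /fps_inv_unit []. Qed.
Fact fps_unitP f g : g * f = 1 /\ f * g = 1 -> fps_unit f.
Proof. by move=> fg; apply/asboolP; exists g. Qed.
Fact fps_inv_out : {in [predC fps_unit], fps_inv =1 id}.
Proof.
move=> f; rewrite inE /= /fps_inv => nuf; case: pselect => // uf.
by case/negP: nuf; apply/asboolP.
Qed.

HB.instance Definition _ := GRing.NzRing_hasMulInverse.Build (fps R)
  fps_mulVr fps_mulrV fps_unitP fps_inv_out.

Definition tmono n (c : R) : fps R := fun m => if m == n then c else 0.

(** Coefficientwise (i.e. [t]-adic) convergence of a sequence of series. *)
Definition fps_cvg (F : nat -> fps R) f :=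
  forall n, exists N0, forall N, (N0 <= N)%N -> F N n = f n.

Lemma fps0E n : (0 : fps R) n = 0. Proof. by []. Qed.
Lemma fps1E n : (1 : fps R) n = (n == 0%N)%:R. Proof. by []. Qed.
Lemma fpsDE f g n : (f + g) n = f n + g n. Proof. by []. Qed.
Lemma fpsNE f n : (- f) n = - f n. Proof. by []. Qed.
Lemma fpsME f g n : (f * g) n = \sum_(i < n.+1) f i * g (n - i)%N.
Proof. by []. Qed.

Lemma fps_sumE (I : Type) (r : seq I) (P : pred I) (F : I -> fps R) n :
  (\sum_(i <- r | P i) F i) n = \sum_(i <- r | P i) F i n.
Proof. exact: (big_morph (fun f : fps R => f n)). Qed.

Lemma fpsX_small (u : fps R) k n : u 0%N = 0 -> (n < k)%N -> (u ^+ k) n = 0.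
Proof.
move=> u0; elim: k n => // k IH n ltnk; rewrite exprS fpsME big1 // => i _.
case: (posnP i) => [->|i_gt0]; first by rewrite u0 mul0r.
rewrite IH ?mulr0 // ltn_subLR; last by rewrite -ltnS.
by rewrite (leq_trans ltnk) // -[k.+1]add1n leq_add2r.
Qed.

Lemma fps_const1_unit f : f 0%N = 1 -> f \is a GRing.unit.
Proof.
move=> f0; pose u : fps R := 1 - f.
have u0 : u 0%N = 0 by rewrite /u fpsDE fps1E fpsNE f0 subrr.
have -> : f = 1 - u by rewrite /u subKr.
pose S n : fps R := \sum_(k < n) u ^+ k.
pose g : fps R := fun n => S n.+1 n.
have gE n i : (i < n.+1)%N -> g i = S n.+1 i.
  move=> lein; rewrite /g /S -(subnKC lein) !fps_sumE big_split_ord /=.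
  by rewrite [X in _ = _ + X]big1 ?addr0 // => j _; rewrite fpsX_small // ltn_addr.
have SE n : (1 - u) * S n = 1 - u ^+ n.
  by rewrite -[1 - u]opprB -[1 - u ^+ n]opprB mulNr subrX1.
have cSE n : S n * (1 - u) = (1 - u) * S n.
  apply: commrB; first exact: commr1.
  by apply/commr_sym/commr_sum => i _; exact/commrX/commr_refl.
have small n : (1 - u ^+ n.+1) n = (1 : fps R) n.
  by rewrite fpsDE fpsNE fpsX_small // subr0.
apply/unitrP; exists g; split; apply: funext => n.
  rewrite fpsME -small -SE -cSE fpsME; apply: eq_bigr => i _.
  by rewrite (gE n).
rewrite fpsME -small -SE fpsME; apply: eq_bigr => i _.
by rewrite (gE n) // ltnS leq_subr.
Qed.

Lemma geomE n q m : (0 < n)%N ->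
  (1 - tmono n q)^-1 m =
  (m == 0%N)%:R + (if (n <= m)%N then q * (1 - tmono n q)^-1 (m - n)%N else 0).
Proof.
move=> n_gt0; set P := (1 - tmono n q)^-1.
have u : 1 - tmono n q \is a GRing.unit.
  apply: fps_const1_unit; rewrite fpsDE fpsNE /tmono fps1E.
  by rewrite [0%N == n]ltn_eqF ?subr0.
have {1}-> : P = 1 + tmono n q * P.
  by apply/eqP; rewrite -subr_eq -[X in X - _]mul1r -mulrBl; apply/eqP/divrr.
rewrite fpsDE fps1E fpsME; congr (_ + _).
case: leqP => [lenm|ltmn].
  rewrite (bigD1 (Ordinal (lenm : (n < m.+1)%N))) //= /tmono eqxx big1 ?addr0 //.
  by move=> i /negbTE; rewrite -val_eqE /= => ->; rewrite mul0r.
rewrite big1 // => i _; rewrite /tmono ltn_eqF ?mul0r //.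
by rewrite (leq_ltn_trans _ ltmn) // -ltnS.
Qed.

End Fps.

(** The free associative algebra on [Lambda_1, Lambda_2, ...], as the algebra
    of the free monoid on [nat], where the generator [k] stands for
    [Lambda_(k+1)]. *)
Notation Sym := {malg rat[{fmonom nat}]}.

Definition Lambda (n : nat) : Sym := if n is k.+1 then << fmu k >> else 1.

(** [\sum_k (-t)^k Lambda_k], then [sigma_t] and its coefficients [S_n]. *)
Definition lambda_neg : fps Sym := fun k => (-1) ^+ k * Lambda k.
Definition sigma : fps Sym := lambda_neg^-1.
Definition Scomplete (n : nat) : Sym := sigma n.

Lemma lambda_neg_unit : lambda_neg \is a GRing.unit.
Proof. by apply: fps_const1_unit; rewrite /lambda_neg mul1r. Qed.

Definition witt_prod (Q : nat -> Sym) (N : nat) : fps Sym :=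
  \prod_(1 <= i < N.+1) (1 - tmono i (Q i))^-1.

(** The identity defining the [Q_n], [n >= 1]; [Q 0] plays no role. *)
Definition witt_identity (Q : nat -> Sym) := fps_cvg (witt_prod Q) sigma.

Lemma witt_prodS Q N :
  witt_prod Q N.+1 = witt_prod Q N * (1 - tmono N.+1 (Q N.+1))^-1.
Proof. by rewrite /witt_prod big_nat_recr. Qed.

Lemma witt_prod_small Q N m : (m <= N)%N -> witt_prod Q N.+1 m = witt_prod Q N m.
Proof.
move=> lemN; rewrite witt_prodS fpsME big_ord_recr /= subnn geomE //= addr0 mulr1.
rewrite big1 ?add0r // => i _; rewrite geomE // subn_eq0 leqNgt ltn_ord add0r.
by rewrite leqNgt ltnS (leq_trans (leq_subr _ _) lemN) mulr0.
Qed.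

Lemma witt_prod_stable Q N m : (m <= N)%N -> witt_prod Q N m = witt_prod Q m m.
Proof.
move=> /subnKC <-; elim: (N - m)%N => [|k IH]; first by rewrite addn0.
by rewrite addnS witt_prod_small // leq_addr.
Qed.

Lemma witt_prod_0 Q N : witt_prod Q N 0%N = 1.
Proof. by rewrite witt_prod_stable // /witt_prod big_geq. Qed.

Lemma witt_prod_new Q N :
  witt_prod Q N.+1 N.+1 = Q N.+1 + witt_prod Q N N.+1.
Proof.
rewrite witt_prodS fpsME big_ord_recr /= subnn geomE //= addr0 mulr1.
congr (_ + _); rewrite big_ord_recl witt_prod_0 mul1r /= subn0 geomE //=.
rewrite leqnn subnn add0r geomE //= addr0 mulr1 big1 ?addr0 // => i _.
rewrite geomE // /bump add1n subSS subn_eq0 leqNgt ltn_ord add0r.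
by rewrite leqNgt ltnS leq_subr mulr0.
Qed.

Lemma witt_identityP Q :
  witt_identity Q <-> forall m, witt_prod Q m m = sigma m.
Proof.
split=> [wQ m|wQ m]; last by exists m => N /witt_prod_stable ->.
have [N0 /(_ (maxn m N0))] := wQ m.
by rewrite leq_maxr witt_prod_stable ?leq_maxl // => ->.
Qed.

Lemma sigma0 : sigma 0%N = 1.
Proof.
have /(congr1 (@^~ 0%N)) := divrr lambda_neg_unit.
by rewrite fpsME big_ord1 /lambda_neg !mul1r.
Qed.

Lemma witt_exists : exists Q : nat -> Sym, witt_identity Q.
Proof.
pose step n (G : fps Sym) := G * (1 - tmono n.+1 (sigma n.+1 - G n.+1))^-1.
pose G := fix G n : fps Sym := if n is n'.+1 then step n' (G n') else 1.
pose Q n : Sym := if n is n'.+1 then sigma n - G n' n else 0.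
have GE N : G N = witt_prod Q N.
  by elim: N => [|N IH]; rewrite ?witt_prodS -?IH // /witt_prod big_geq.
exists Q; apply/witt_identityP => -[|n]; first by rewrite witt_prod_0 sigma0.
by rewrite witt_prod_new /Q -GE subrK.
Qed.

Lemma witt_unique (Q Q' : nat -> Sym) : witt_identity Q -> witt_identity Q' ->
  forall n, (0 < n)%N -> Q n = Q' n.
Proof.
move=> /witt_identityP wQ /witt_identityP wQ'.
suff E N : witt_prod Q N = witt_prod Q' N.
  case=> // n _; have := wQ n.+1; rewrite -wQ' !witt_prod_new E.
  exact: addIr.
elim: N => [|N IH]; first by rewrite /witt_prod !big_geq.
have := wQ N.+1; rewrite -wQ' !witt_prod_new IH !witt_prodS IH.
by move=> /addIr ->.
Qed.

Definition Witt : nat -> Sym := sval (cid witt_exists).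

Lemma WittP : witt_identity Witt.
Proof. by rewrite /Witt; case: cid. Qed.

(** [f : ncseries A K], i.e. an element of [K<<A>>], stands for [\sum_w (f w) w];
    the alphabet [A] may be infinite. *)

Definition ncseries (A : Type) (K : nzRingType) : Type := seq A -> K.

Section Ncseries.
Variables (A : Type) (K : comNzRingType).
Implicit Types (f g h : ncseries A K) (w : seq A).

HB.instance Definition _ := gen_eqMixin (ncseries A K).
HB.instance Definition _ := gen_choiceMixin (ncseries A K).

Definition nc_zero : ncseries A K := fun=> 0.
Definition nc_opp f : ncseries A K := fun w => - f w.
Definition nc_add f g : ncseries A K := fun w => f w + g w.
Definition nc_one : ncseries A K := fun w => (nilp w)%:R.
Definition nc_mul f g : ncseries A K :=
  fun w => \sum_(i < (size w).+1) f (take i w) * g (drop i w).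
Definition nc_scale (c : K) f : ncseries A K := fun w => c * f w.

Fact nc_addA : associative nc_add.
Proof. by move=> f g h; apply: funext => n; exact: addrA. Qed.
Fact nc_addC : commutative nc_add.
Proof. by move=> f g; apply: funext => n; exact: addrC. Qed.
Fact nc_add0 : left_id nc_zero nc_add.
Proof. by move=> f; apply: funext => n; exact: add0r. Qed.
Fact nc_addN : left_inverse nc_zero nc_opp nc_add.
Proof. by move=> f; apply: funext => n; exact: addNr. Qed.

HB.instance Definition _ :=
  GRing.isZmodule.Build (ncseries A K) nc_addA nc_addC nc_add0 nc_addN.

Let shift a f : ncseries A K := fun w => f (a :: w).

Let nc_mulS f g a w :
  nc_mul f g (a :: w) = f [::] * g (a :: w) + nc_mul (shift a f) g w.
Proof. by rewrite /nc_mul big_ord_recl. Qed.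

Let nc_mul_0 f g : nc_mul f g [::] = f [::] * g [::].
Proof. by rewrite /nc_mul big_ord1. Qed.

Let nc_mulDn f g h w :
  nc_mul (nc_add f g) h w = nc_mul f h w + nc_mul g h w.
Proof. by rewrite /nc_mul -big_split; apply: eq_bigr => i _; rewrite mulrDl. Qed.

Let nc_mulZn c f g w :
  nc_mul (nc_scale c f) g w = c * nc_mul f g w.
Proof. by rewrite /nc_mul mulr_sumr; apply: eq_bigr => i _; rewrite mulrA. Qed.

Fact nc_mulA : associative nc_mul.
Proof.
move=> f g h; apply: funext => w; elim: w f g h => [|a w IH] f g h.
  by rewrite !nc_mul_0 mulrA.
rewrite !nc_mulS nc_mul_0 IH mulrDr mulrA -addrA; congr (_ + _).
rewrite -nc_mulZn -nc_mulDn; congr (nc_mul _ _ _).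
by apply: funext => m; rewrite /shift nc_mulS.
Qed.

Fact nc_mul1l : left_id nc_one nc_mul.
Proof.
move=> f; apply: funext => w.
rewrite /nc_mul big_ord_recl take0 drop0 mul1r big1 ?addr0 // => i _.
by rewrite /nc_one /nilp size_take lift0; case: w i => [[]//|a w i]; case: ifP;
  rewrite mul0r.
Qed.

Fact nc_mul1r : right_id nc_one nc_mul.
Proof.
move=> f; apply: funext => w.
rewrite /nc_mul big_ord_recr /= take_size drop_size mulr1 big1 ?add0r // => i _.
by rewrite /nc_one /nilp size_drop subn_eq0 leqNgt ltn_ord mulr0.
Qed.

Fact nc_mulDl : left_distributive nc_mul nc_add.
Proof. by move=> f g h; apply: funext => n; exact: nc_mulDn. Qed.

Fact nc_mulDr : right_distributive nc_mul nc_add.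
Proof.
move=> f g h; apply: funext => n; rewrite /nc_mul /nc_add -big_split.
by apply: eq_bigr => i _; rewrite mulrDr.
Qed.

Fact nc_one_neq0 : nc_one != 0.
Proof. by apply/eqP => /(congr1 (@^~ [::])) /eqP; rewrite /nc_one oner_eq0. Qed.

HB.instance Definition _ := GRing.Zmodule_isNzRing.Build (ncseries A K)
  nc_mulA nc_mul1l nc_mul1r nc_mulDl nc_mulDr nc_one_neq0.

Fact nc_scaleA c d f : nc_scale c (nc_scale d f) = nc_scale (c * d) f.
Proof. by apply: funext => w; exact: mulrA. Qed.
Fact nc_scale1 : left_id 1 nc_scale.
Proof. by move=> f; apply: funext => w; exact: mul1r. Qed.
Fact nc_scaleDr : right_distributive nc_scale +%R.
Proof. by move=> c f g; apply: funext => w; exact: mulrDr. Qed.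
Fact nc_scaleDl f : {morph nc_scale^~ f : c d / c + d}.
Proof. by move=> c d; apply: funext => w; exact: mulrDl. Qed.

HB.instance Definition _ := GRing.Zmodule_isLmodule.Build K (ncseries A K)
  nc_scaleA nc_scale1 nc_scaleDr nc_scaleDl.

Fact nc_scaleAl (c : K) f g : c *: (f * g) = c *: f * g.
Proof. by apply: funext => w; exact/esym/nc_mulZn. Qed.

HB.instance Definition _ :=
  GRing.Lmodule_isLalgebra.Build K (ncseries A K) nc_scaleAl.

Fact nc_scaleAr (c : K) f g : c *: (f * g) = f * (c *: g).
Proof.
apply: funext => w; rewrite /GRing.scale /GRing.mul /= /nc_scale /nc_mul mulr_sumr.
by apply: eq_bigr => i _; rewrite mulrCA.
Qed.

HB.instance Definition _ :=
  GRing.Lalgebra_isAlgebra.Build K (ncseries A K) nc_scaleAr.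

Definition charser (S : set (seq A)) : ncseries A K := fun w => (w \in S)%:R.

End Ncseries.

Arguments charser {A K} S.

Definition deg_part (A : Type) (C : set (seq A)) (n : nat) : set (seq A) :=
  C `&` [set w | size w = n].

Section Specialization.
Variables (A : Type) (C : set (seq A)).

Definition spec_gen (n : nat) : ncseries A rat :=
  (-1) ^+ n.-1 *: charser (deg_part C n).

Definition spec_monom (m : {fmonom nat}) : ncseries A rat :=
  \prod_(k <- (m : seq nat)) spec_gen k.+1.

Fact spec_monom_mmorphism : mmorphism spec_monom.
Proof.
by split=> [m m'|]; rewrite /spec_monom ?fmM ?big_cat // fm1 big_nil.
Qed.

HB.instance Definition _ := isMultiplicative.Build {fmonom nat} (ncseries A rat)
  spec_monom spec_monom_mmorphism.

(** [spec F] is [F[C]]; [specP] and [spec_unique] say that it is the algebra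
    morphism determined by [Lambda_n[C] = (-1)^(n-1) C_n], [n >= 1]. *)
Definition spec : Sym -> ncseries A rat :=
  mmap (in_alg (ncseries A rat)) spec_monom.

Fact spec_zmod : zmod_morphism spec.
Proof. exact: mmap_is_additive. Qed.
HB.instance Definition _ :=
  GRing.isZmodMorphism.Build Sym (ncseries A rat) spec spec_zmod.

Fact spec_monoid : monoid_morphism spec.
Proof.
have comm (g : Sym) (m m' : {fmonom nat}) :
    GRing.comm (in_alg (ncseries A rat) g@_m) (spec_monom m').
  by rewrite /GRing.comm /= mulr_algl mulr_algr.
by have [? ?] := commr_mmap_is_multiplicative comm.
Qed.
HB.instance Definition _ :=
  GRing.isMonoidMorphism.Build Sym (ncseries A rat) spec spec_monoid.

Fact spec_scalable : scalable spec.
Proof. by move=> c F; rewrite /spec mmapZ /= mulr_algl. Qed.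
HB.instance Definition _ :=
  GRing.isScalable.Build rat Sym (ncseries A rat) *:%R spec spec_scalable.

Lemma specP n : (0 < n)%N -> spec (Lambda n) = spec_gen n.
Proof.
case: n => // n _; rewrite /spec mmapU /= scale1r mul1r.
by rewrite /spec_monom fmU big_seq1.
Qed.

End Specialization.

Lemma spec_unique (A : Type) (C : set (seq A))
    (phi : {lrmorphism Sym -> ncseries A rat}) :
  (forall n, (0 < n)%N -> phi (Lambda n) = spec_gen C n) -> phi =1 spec C.
Proof.
move=> phiL F; rewrite [F]monalgE !raddf_sum; apply: eq_bigr => m _.
have -> : << F@_m *g m >> = F@_m *: << m >> :> Sym.
  apply/malgP => m0; rewrite linearZ /= !mcoeffU.
  by case: (_ == _); rewrite ?mulr1 ?mulr0.
rewrite /= [LHS]linearZZ [RHS]linearZZ; congr (_ *: _).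
case: m => s; elim: s => [|k s IH].
  have -> : FMonom [::] = mone :> {fmonom nat} by rewrite /mone /one /= fmoneE.
  by rewrite -[<< _ >>]/(1 : Sym) !rmorph1.
have -> : FMonom (k :: s) = mmul (fmu k) (FMonom s) :> {fmonom nat}.
  by rewrite /mmul /mul /= fmmulE fmuE.
have -> : << mmul (fmu k) (FMonom s) >> = Lambda k.+1 * << FMonom s >> :> Sym.
  by rewrite malgM_def fgmulUU mulr1.
by rewrite !rmorphM /= IH -[<< fmu k >>]/(Lambda k.+1) phiL // specP.
Qed.

Section Codes.
Variable A : Type.
Implicit Types (X Y C M : set (seq A)).

Definition star X : set (seq A) :=
  [set flatten s | s in [set s : seq (seq A) | all (fun w => w \in X) s]].

Definition setcat X Y : set (seq A) :=
  [set w | exists u v, [/\ X u, Y v & w = u ++ v]].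

Definition submonoid M :=
  M [::] /\ forall u v, M u -> M v -> M (u ++ v).

Definition free_submonoid M :=
  submonoid M /\
  exists (B : Type) (phi : seq B -> seq A),
    [/\ phi [::] = [::], forall u v, phi (u ++ v) = phi u ++ phi v,
        injective phi & range phi = M].

Definition minimal_generating_set X M :=
  star X = M /\ forall Y, Y `<=` X -> star Y = M -> Y = X.

Definition is_code C :=
  [/\ ~ C [::], free_submonoid (star C) & minimal_generating_set C (star C)].

End Codes.

(** The weights [omega b] are meant to be positive, as lengths of code words
    are. *)
Section WeightFactorization.
Variables (B : Type) (omega : B -> nat).

Definition weight (w : seq B) : nat := \sum_(b <- w) omega b.

Definition weight_part (Z : set (seq B)) (i : nat) : set (seq B) :=
  Z `&` [set w | weight w = i].

(** [wfZ_from1 k] is [Z_(k+1)]. *)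
Fixpoint wfZ_from1 (k : nat) : set (seq B) :=
  if k is k'.+1 then
    let Z := wfZ_from1 k' in
    let D := weight_part Z k in
    setcat (Z `\` D) (star D)
  else [set [:: b] | b in setT].

(** [wfZ i] and [wfD i] are [Z_i] and [D_i] for [i >= 1]. *)
Definition wfZ (i : nat) : set (seq B) := wfZ_from1 i.-1.
Definition wfD (i : nat) : set (seq B) := weight_part (wfZ i) i.

Lemma wfZ1 : wfZ 1 = [set [:: b] | b in setT].
Proof. by []. Qed.

Lemma wfZS i : (0 < i)%N -> wfZ i.+1 = setcat (wfZ i `\` wfD i) (star (wfD i)).
Proof. by case: i. Qed.

End WeightFactorization.

(** The finite or infinite sequence obtained from [(s 1, s 2, ...)] by omitting
    the empty sets: its [k]-th term (from [k = 0]) is [Some (s i)] when [s i] is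
    the [k]-th nonempty set, and [None] beyond its end. *)
Definition omit_empty (T : Type) (s : nat -> set T) (k : nat) :
    option (set T) :=
  let nonempty i := `[< s i !=set0 >] in
  let kth i := [/\ (0 < i)%N, nonempty i & count nonempty (iota 1 i.-1) = k] in
  if pselect (exists i, kth i) is left e then Some (s (sval (cid e))) else None.

Definition weight_factorization (B : Type) (omega : B -> nat) :
    nat -> option (set (seq B)) :=
  omit_empty (wfD omega).

(** [C] itself, as a type, is the alphabet, and words over it are read in [A^*]
    through the embedding of the free monoid over [C], with image [C^*]. *)
Definition code_word (A : Type) (C : set (seq A)) (w : seq C) : seq A :=
  flatten [seq val c | c <- w].

Definition right_length_factorization (A : Type) (C : set (seq A)) :
    nat -> option (set (seq A)) :=
  fun k => omap (fun D => [set code_word w | w in D])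
    (weight_factorization (fun c : C => size (val c)) k).

(* Main.v *)
Require Import Defs.
From HB Require Import structures.
From mathcomp Require Import all_boot all_order all_algebra.
From mathcomp Require Import boolp classical_sets.
From mathcomp Require Import monalg.

Set Implicit Arguments.
Unset Strict Implicit.
Unset Printing Implicit Defensive.

Import GRing.Theory.

Local Open Scope classical_set_scope.
Local Open Scope ring_scope.

(** The theorem is a computation with formal power series that mirrors the
    elimination steps of the length factorization.

    A set [C] of words is a code exactly when every word has at most one
    factorization over [C] ([is_code_unique_factorization] and
    [unique_factorization_is_code]).  If [X] has this property and [D] is a
    subset of [X], then so does [X' = (X \ D) D^*]
    ([unique_factorization_eliminate]), because a product of elements of [X'],
    rewritten over [X], is cut back into its factors just before each element
    of [X \ D].  As the products in [X' = (X \ D) D^*] and in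
    [D^* = {1} + D^* D] are unambiguous, characteristic series satisfy
    [X' = (X - D) (1 - D)^-1], that is, [1 - X' = (1 - X) (1 - D)^-1]
    ([charser_eliminate]).

    Let [Z_1 = C, Z_2, Z_3, ...] be the codes obtained by eliminating from [Z_i]
    its set [D_i] of words of length [i], and put a variable [t] in front of
    each letter.  Iterating the last identity gives
    [(1 - t D_1)^-1 ... (1 - t^N D_N)^-1 = (1 - C(t))^-1 (1 - Z_(N+1)(t))],
    where [Z_(N+1)(t)] has no term of degree at most [N] since all words of
    [Z_(N+1)] are longer than [N].  On the other side, the specialization at [C]
    sends [sum_k (-t)^k Lambda_k] to [1 - C(t)] ([spec_lambda_neg]), hence
    [sigma_t] to [(1 - C(t))^-1].  Comparing the coefficients of degree [N+1] in
    the identity defining the Witt functions then gives [Q_(N+1)[C] = D_(N+1)],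
    by induction on [N] ([spec_Witt_prod]).

    All this takes place in [A^*].  The factorization [F(C,l)] lives in the free
    monoid over [C], but the injective morphism [code_word] commutes with the
    elimination steps, so it carries one construction to the other
    ([image_wfD]). *)

(** * Codes as sets with unique factorization *)

Section UniqueFactorization.
Variable A : Type.
Implicit Types (X Y D : set (seq A)) (s t : seq (seq A)).

Definition unique_factorization X :=
  forall s t, all (fun w => w \in X) s -> all (fun w => w \in X) t ->
    flatten s = flatten t -> s = t.

Lemma unique_factorization_nonempty X :
  unique_factorization X -> ~ X [::].
Proof.
move=> uX X0; have := uX [:: [::]] [::].
by rewrite /= mem_set // => /(_ isT isT erefl).
Qed.

Lemma all_subset X Y s :
  X `<=` Y -> all (fun w => w \in X) s -> all (fun w => w \in Y) s.
Proof. by move=> sXY; apply: sub_all => w /set_mem /sXY /mem_set. Qed.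

Lemma all_map_range (T : Type) (f : T -> seq A) X (u : seq T) :
  range f `<=` X -> all (fun w => w \in X) (map f u).
Proof.
move=> fX; elim: u => //= x u ->; rewrite andbT mem_set //.
by apply: fX; exists x.
Qed.

Lemma all_map_val X (u : seq X) : all (fun w => w \in X) (map val u).
Proof. by apply: all_map_range => _ [x _ <-]; exact/set_mem/valP. Qed.

Lemma unique_factorization_sub X Y :
  X `<=` Y -> unique_factorization Y -> unique_factorization X.
Proof.
by move=> sXY uY s t /(all_subset sXY) Ys /(all_subset sXY); exact: uY.
Qed.

(** If [phi] is an isomorphism from the free monoid over [B] onto [X^*], then
    [phi b], for a letter [b], cannot be a product of two nonempty words of
    [X^*], so it belongs to [X].  The letters already generate [X^*], so by
    minimality [X] is the set of their images, and factorizations over [X]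
    correspond to words over [B]. *)
Lemma is_code_unique_factorization X : is_code X -> unique_factorization X.
Proof.
case=> X0 [_ [B [phi [phi0 phiM phi_inj phiX]]]] [_ minX].
have phi_flatten (us : seq (seq B)) : phi (flatten us) = flatten (map phi us).
  by elim: us => //= u us IH; rewrite phiM IH.
have lift s : all (fun w => w \in X) s ->
    exists2 us : seq (seq B), map phi us = s & all (fun u => phi u \in X) us.
  elim: s => [|w s IH] /=; first by exists [::].
  case/andP=> Xw /IH [us <- Xus].
  have : star X w by exists [:: w]; rewrite /= ?Xw ?cats0.
  by rewrite -phiX => -[u _ phiu]; exists (u :: us); rewrite /= ?phiu ?Xw.
pose Y : set (seq A) := [set phi [:: b] | b in setT].
have sYX : Y `<=` X.
  move=> _ [b _ <-].
  have : star X (phi [:: b]) by rewrite -phiX; exists [:: b].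
  move=> [s /lift[us <- Xus]]; rewrite -phi_flatten => /phi_inj.
  case: us Xus => [|[|b1 u] us] //=; first by rewrite phi0 => /andP[/set_mem].
  by case/andP=> /set_mem Xu _ [<-]; case: u Xu.
have flatten_letters u : flatten [seq phi [:: b] | b <- u] = phi u.
  by elim: u => //= b u IH; rewrite -[b :: u]cat1s phiM IH.
have XY : Y = X.
  apply: minX => //; apply/seteqP; split=> w.
    by case=> s /(all_subset sYX) Xs <-; exists s.
  rewrite -phiX => -[u _ <-].
  exists [seq phi [:: b] | b <- u]; last exact: flatten_letters.
  exact: all_map_range.
have letters s : all (fun w => w \in X) s ->
    exists u, s = [seq phi [:: b] | b <- u].
  elim: s => [|w s IH] /=; first by exists [::].
  case/andP=> /set_mem; rewrite -{1}XY => -[b _ <-] /IH[u ->].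
  by exists (b :: u).
move=> s t /letters[u ->] /letters[v ->].
by rewrite !flatten_letters => /phi_inj ->.
Qed.

Lemma unique_factorization_is_code X : unique_factorization X -> is_code X.
Proof.
move=> uX; split; first exact: unique_factorization_nonempty.
- split.
    split; first by exists [::].
    move=> _ _ [s Xs <-] [t Xt <-]; exists (s ++ t); last exact: flatten_cat.
    by rewrite /= all_cat Xs Xt.
  exists X, (@code_word A X); split=> //.
  + by move=> u v; rewrite /code_word map_cat flatten_cat.
  + move=> u v /uX uv.
    by apply: (inj_map val_inj); apply: uv => //; exact: all_map_val.
  + apply/seteqP; split=> w.
      by case=> u _ <-; exists (map val u) => //=; exact: all_map_val.
    case=> s /= Xs <-; elim: s Xs => [_|x s IH /= /andP[Xx /IH[u _ us]]].
      by exists [::].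
    by exists ((exist _ x Xx : X) :: u) => //; rewrite /code_word /= -us.
- split=> // Y sYX starYX; apply/seteqP; split=> // x Xx.
  have : star Y x by rewrite starYX; exists [:: x]; rewrite /= ?mem_set ?cats0.
  case=> s Ys sx; have := uX s [:: x] (all_subset sYX Ys).
  rewrite /= mem_set // cats0 => /(_ isT sx) sE.
  by move: Ys; rewrite sE /= andbT => /set_mem.
Qed.

(** * Elimination of a part of a code *)

Definition eliminate X D : set (seq A) := setcat (X `\` D) (star D).

(** The maximal prefix over [D] of a list is determined by the list; this
    recovers the starred factor of an element of [eliminate X D] from a
    factorization over [X].  The empty list is a case apart, because on it
    [head] returns a default word that may well lie in [D]. *)
Lemma eq_cat_prefix D s s' t t' :
  all (fun w => w \in D) s -> all (fun w => w \in D) s' ->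
  head [::] t \notin D \/ t = [::] -> head [::] t' \notin D \/ t' = [::] ->
  s ++ t = s' ++ t' -> s = s' /\ t = t'.
Proof.
move=> Ds Ds' tD t'D.
elim: s s' Ds Ds' => [|x s IH] [|y s'] //=.
- by move=> _ /andP[Dy _] tE; move: tD; rewrite tE /= Dy => -[].
- by move=> /andP[Dx _] _ tE; move: t'D; rewrite -tE /= Dx => -[].
- by move=> /andP[_ Ds] /andP[_ Ds'] [-> /(IH _ Ds Ds')[-> ->]].
Qed.

(** Besides the factorization over [X], what matters is that it starts
    outside [D]: this marks the end of the starred factor that precedes [s]. *)
Lemma star_eliminate X D s : D `<=` X ->
  all (fun w => w \in eliminate X D) s ->
  exists t, [/\ all (fun w => w \in X) t, flatten t = flatten s
              & head [::] t \notin D \/ t = [::]].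
Proof.
move=> sDX; elim: s => [|w s IH] /=; first by exists [::]; split=> //; right.
case/andP=> /set_mem[c [_ [[Xc nDc] [ds Dds <-] ->]]] /IH[t [Xt <- _]].
exists (c :: ds ++ t); split; last by left; rewrite /= notin_setE.
  by rewrite /= all_cat mem_set //= (all_subset sDX).
by rewrite /= flatten_cat catA.
Qed.

Lemma unique_factorization_eliminate X D : D `<=` X ->
  unique_factorization X -> unique_factorization (eliminate X D).
Proof.
move=> sDX uX; have X0 := unique_factorization_nonempty uX.
have Z0 : ~ eliminate X D [::].
  by case=> c [v [[Xc _] _]]; case: c Xc.
elim=> [|x s IH] [|y t] //=.
- by move=> _ /andP[/set_mem Zy _]; case: y Zy.
- by move=> /andP[/set_mem Zx _] _; case: x Zx.
case/andP=> /set_mem[c [_ [[Xc nDc] [ds Dds <-] ->]]] Zs.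
case/andP=> /set_mem[c' [_ [[Xc' nDc'] [ds' Dds' <-] ->]]] Zt.
have [s1 [Xs1 s1E hs1]] := star_eliminate sDX Zs.
have [t1 [Xt1 t1E ht1]] := star_eliminate sDX Zt.
rewrite -s1E -t1E => eq_st.
have := uX (c :: ds ++ s1) (c' :: ds' ++ t1).
rewrite /= !all_cat !mem_set //= (all_subset sDX Dds) (all_subset sDX Dds').
rewrite !flatten_cat !catA => /(_ Xs1 Xt1 eq_st)[->].
move=> /(eq_cat_prefix Dds Dds' hs1 ht1)[-> st1].
by congr (_ :: _); apply: IH => //; rewrite -s1E -t1E st1.
Qed.

End UniqueFactorization.

(** * Characteristic series of unambiguous operations *)

Section CharacteristicSeries.
Variables (A : Type) (K : comNzRingType).
Implicit Types (X Y D : set (seq A)).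

Local Notation chi X := (charser X : ncseries A K).

Lemma charser1 : chi [set [::]] = 1.
Proof.
apply: funext => -[|a w]; rewrite /charser.
  by rewrite mem_set.
by rewrite memNset.
Qed.

Lemma charserU X Y : X `&` Y = set0 -> chi (X `|` Y) = chi X + chi Y.
Proof.
move=> XY; apply: funext => w.
rewrite -[RHS]/(chi X w + chi Y w) /charser in_setU.
case: (boolP (w \in X)) => [/set_mem Xw|_]; last by rewrite add0r.
rewrite memNset ?addr0 // => Yw.
by have : (X `&` Y) w by []; rewrite XY.
Qed.

Lemma charserD X D : D `<=` X -> chi (X `\` D) = chi X - chi D.
Proof.
move=> sDX; apply/eqP; rewrite eq_sym subr_eq -charserU ?setDKU //.
by rewrite setDKI.
Qed.

Definition unambiguous X Y := forall u u' v v',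
  X u -> X u' -> Y v -> Y v' -> u ++ v = u' ++ v' -> u = u'.

(** The coefficient of [w] in the product counts the cuts of [w] into a word of
    [X] followed by a word of [Y]; there is at most one. *)
Lemma charser_cat X Y :
  unambiguous X Y -> chi (setcat X Y) = chi X * chi Y.
Proof.
move=> uXY; apply: funext => w; rewrite /GRing.mul /= /nc_mul /charser.
case: (pselect (setcat X Y w)) => [XYw|nXYw].
  rewrite mem_set //; case: XYw => u [v [Xu Yv ->]].
  have ltu : (size u < (size (u ++ v)).+1)%N by rewrite ltnS size_cat leq_addr.
  rewrite (bigD1 (Ordinal ltu)) //= take_size_cat // drop_size_cat //.
  rewrite !mem_set // mulr1 big1 ?addr0 // => i /eqP neq_i.
  case: (boolP (take i _ \in X)) => [/set_mem Xi|]; last by rewrite mul0r.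
  case: (boolP (drop i _ \in Y)) => [/set_mem Yi|]; last by rewrite mulr0.
  case: neq_i; apply: val_inj => /=.
  have /(congr1 size) : u = take i (u ++ v).
    by apply: uXY Yv Yi _ => //; rewrite cat_take_drop.
  by rewrite size_takel // -ltnS.
rewrite memNset // big1 // => i _.
case: (boolP (take i w \in X)) => [/set_mem Xi|]; last by rewrite mul0r.
case: (boolP (drop i w \in Y)) => [/set_mem Yi|]; last by rewrite mulr0.
by case: nXYw; exists (take i w), (drop i w); rewrite cat_take_drop.
Qed.

(** The unambiguous decomposition behind this is [D^* = {1} + D^* D], which
    splits off the last factor. *)
Lemma charser_star D :
  unique_factorization D -> chi (star D) * (1 - chi D) = 1.
Proof.
move=> uD; have D0 := unique_factorization_nonempty uD.
rewrite mulrBr mulr1 -charser_cat; last first.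
  move=> _ _ v v' [s Ds <-] [t Dt <-] Dv Dv' eq_st.
  have := uD (rcons s v) (rcons t v').
  rewrite !all_rcons !mem_set // !flatten_rcons.
  by move=> /(_ Ds Dt eq_st) /rcons_inj[->].
apply/eqP; rewrite subr_eq -charser1 -charserU; last first.
  apply/seteqP; split=> // w [/= ->] [u [v [_ Dv]]].
  by case: u => //; case: v Dv.
apply/eqP; congr charser; apply/seteqP; split=> w.
  case=> s; case/lastP: s => [|s v]; first by left.
  rewrite /= all_rcons => /andP[/set_mem Dv Ds] <-; right.
  by exists (flatten s), v; rewrite flatten_rcons; split=> //; exists s.
case=> [->|[_ [v [[s Ds <-] Dv ->]]]]; first by exists [::].
by exists (rcons s v); rewrite ?flatten_rcons //= all_rcons mem_set.
Qed.

(** Stated without inverses: it follows from [charser_star] and the unambiguous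
    product [(X \ D) D^*] after multiplication by [1 - D] on the right. *)
Lemma charser_eliminate X D : D `<=` X -> unique_factorization X ->
  (1 - chi (eliminate X D)) * (1 - chi D) = 1 - chi X.
Proof.
move=> sDX uX; rewrite charser_cat; last first.
  move=> c c' _ _ [Xc _] [Xc' _] [s Ds <-] [t Dt <-] eq_st.
  have := uX (c :: s) (c' :: t).
  by rewrite /= !mem_set //= !(all_subset sDX) // => /(_ isT isT eq_st)[].
rewrite mulrBl mul1r -mulrA charser_star ?mulr1.
  by rewrite charserD // opprB addrA subrK.
exact: unique_factorization_sub uX.
Qed.

End CharacteristicSeries.

(** * Grading by length *)

Section Grading.
Variables (A : Type) (K : comNzRingType).
Implicit Types (f g : ncseries A K).

(** The substitution of [t a] for each letter [a]; it is a ring morphism, so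
    identities between series pass to their graded versions. *)
Definition graded f : fps (ncseries A K) :=
  fun n w => if size w == n then f w else 0.

Lemma nc_sumE (I : Type) (r : seq I) (P : pred I) (F : I -> ncseries A K) w :
  (\sum_(i <- r | P i) F i) w = \sum_(i <- r | P i) F i w.
Proof. exact: (big_morph (fun f : ncseries A K => f w)). Qed.

Fact graded_zmod : zmod_morphism graded.
Proof.
move=> f g; apply: funext => n; apply: funext => w.
rewrite -[RHS]/(graded f n w - graded g n w) /graded.
by case: eqP => // _; rewrite subr0.
Qed.
HB.instance Definition _ :=
  GRing.isZmodMorphism.Build _ _ graded graded_zmod.

Fact graded_monoid : monoid_morphism graded.
Proof.
split=> [|f g].
  apply: funext => n; apply: funext => -[|a w]; rewrite fps1E /graded /=.
    by case: n.
  by case: n => [|n]; [|case: ifP].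
apply: funext => n; apply: funext => w; rewrite fpsME nc_sumE.
(* Both sides are sums over cuts of [w] at a position [j]; on the right the
   index [i] must be [j]. *)
transitivity (\sum_(j < (size w).+1) \sum_(i < n.+1)
    graded f i (take j w) * graded g (n - i)%N (drop j w)); last first.
  by rewrite exchange_big.
rewrite {1}/graded; case: eqP => [szw|/eqP szw].
  apply: eq_bigr => j _; have lej : (j <= size w)%N by rewrite -ltnS.
  have ltj : (j < n.+1)%N by rewrite -szw ltn_ord.
  rewrite (bigD1 (Ordinal ltj)) //= /graded size_takel // size_drop.
  have -> : (size w - j = n - j)%N by congr (_ - _)%N.
  rewrite !eqxx.
  rewrite big1 ?addr0 // => i /negbTE; rewrite -val_eqE /= eq_sym => ->.
  by rewrite mul0r.
rewrite big1 // => j _; rewrite big1 // => i _.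
have lej : (j <= size w)%N by rewrite -ltnS.
have lei : (i <= n)%N by rewrite -ltnS.
rewrite /graded size_takel // size_drop.
case: eqP => [eq_j|_]; last by rewrite mul0r.
case: eqP => [eq_w|_]; last by rewrite mulr0.
by case/eqP: szw; rewrite -(subnK lej) eq_w eq_j subnK.
Qed.
HB.instance Definition _ :=
  GRing.isMonoidMorphism.Build _ _ graded graded_monoid.

Lemma graded_charser (X : set (seq A)) n :
  graded (charser X) n = charser (deg_part X n).
Proof.
apply: funext => w; rewrite /graded /charser /deg_part in_setI.
have -> : (w \in [set w | size w = n]) = (size w == n).
  by apply/idP/eqP => [/set_mem //|szw]; exact: mem_set.
by case: eqP; rewrite ?andbT ?andbF.
Qed.

Lemma graded_deg_part (X : set (seq A)) n :
  graded (charser (deg_part X n)) = tmono n (charser (deg_part X n)).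
Proof.
apply: funext => m; rewrite graded_charser /tmono.
case: eqP => [->|neq].
  by congr charser; apply/seteqP; split=> w // [].
by apply: funext => w; rewrite /charser memNset // => -[[_ /= ->] /= /esym].
Qed.

End Grading.

(** * Series in [t] under a morphism of coefficients *)

Section FpsMap.
Variables (R S : nzRingType) (phi : {rmorphism R -> S}).

Definition fps_map (f : fps R) : fps S := fun n => phi (f n).

Fact fps_map_zmod : zmod_morphism fps_map.
Proof. by move=> f g; apply: funext => n; rewrite /fps_map rmorphB. Qed.
HB.instance Definition _ :=
  GRing.isZmodMorphism.Build _ _ fps_map fps_map_zmod.

Fact fps_map_monoid : monoid_morphism fps_map.
Proof.
split=> [|f g]; apply: funext => n; rewrite /fps_map.
  by rewrite !fps1E rmorph_nat.
by rewrite !fpsME rmorph_sum; apply: eq_bigr => i _; rewrite rmorphM.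
Qed.
HB.instance Definition _ :=
  GRing.isMonoidMorphism.Build _ _ fps_map fps_map_monoid.

Lemma fps_map_tmono n c : fps_map (tmono n c) = tmono n (phi c).
Proof.
by apply: funext => m; rewrite /fps_map /tmono; case: ifP; rewrite ?rmorph0.
Qed.

End FpsMap.

Lemma tmono_unit (R : nzRingType) n (c : R) :
  (0 < n)%N -> 1 - tmono n c \is a GRing.unit.
Proof.
move=> n_gt0; apply: fps_const1_unit.
by rewrite fpsDE fpsNE /tmono fps1E [0%N == n]ltn_eqF ?subr0.
Qed.

(** * The length factorization inside the free monoid on the letters *)

Section LengthFactorization.
Variables (A : Type) (C : set (seq A)).

(** The code that remains after the eliminations in lengths [1, ..., k]: the
    image in [A^*] of [Z_(k+1)]. *)
Fixpoint residual (k : nat) : set (seq A) :=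
  if k is k'.+1 then
    eliminate (residual k') (deg_part (residual k') k)
  else C.

Definition length_factor (i : nat) : set (seq A) :=
  deg_part (residual i.-1) i.

Hypothesis uC : unique_factorization C.

Lemma residual_unique_factorization k : unique_factorization (residual k).
Proof.
elim: k => //= k IH.
by apply: unique_factorization_eliminate => // w [].
Qed.

Lemma residual_size k w : residual k w -> (k < size w)%N.
Proof.
elim: k w => [|k IH] w /=.
  by case: w => // /(unique_factorization_nonempty uC).
case=> u [v [[/[dup] Ru /IH ltku nu] _ ->]].
rewrite size_cat ltn_addr // ltn_neqAle ltku andbT.
by apply/eqP => eq_u; apply: nu.
Qed.

Lemma length_factor_is_code i : is_code (length_factor i).
Proof.
apply/unique_factorization_is_code.
apply: unique_factorization_sub (@residual_unique_factorization i.-1).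
by move=> w [].
Qed.

Local Notation gr X := (graded (charser X : ncseries A rat)).

Lemma graded_residual_step k :
  (1 - gr (residual k)) * (1 - tmono k.+1 (charser (length_factor k.+1)))^-1
  = 1 - gr (residual k.+1).
Proof.
apply: (canLR (mulrK (tmono_unit _ _))) => //.
rewrite -graded_deg_part -[1](rmorph1 (graded (A:=A) (K:=rat))) -!rmorphB.
rewrite -rmorphM charser_eliminate //; first by move=> w [].
exact: residual_unique_factorization.
Qed.

(** The sign of [Lambda_n[C] = (-1)^(n-1) C_n] cancels [(-1)^n] up to a global
    minus, and [C] has no word of length zero. *)
Lemma spec_lambda_neg : fps_map (spec C) lambda_neg = 1 - gr C.
Proof.
apply: funext => n; rewrite /fps_map /lambda_neg rmorphM rmorphXn rmorphN1.
rewrite fpsDE fpsNE fps1E graded_charser.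
case: n => [|n].
  rewrite expr0 mul1r rmorph1 -[LHS]subr0; congr (_ - _).
  apply: funext => w; rewrite /charser memNset // => -[Cw /= /size0nil w0].
  by apply: (unique_factorization_nonempty uC); rewrite -w0.
rewrite -[X in _ * X]/(spec C (Lambda n.+1)) specP // /spec_gen sub0r /=.
rewrite -(rmorphN1 (in_alg (ncseries A rat))) -rmorphXn /= mulr_algl.
by rewrite scalerA exprS -mulrA -signr_odd -expr2 sqrr_sign mulr1 scaleN1r.
Qed.

(** The two claims are proved together: the closed form of the product up to
    [N] gives its coefficient of degree [N.+1], hence the value of
    [Witt N.+1], and this value gives the closed form up to [N.+1]. *)
Lemma spec_Witt_prod N :
  (forall i, (0 < i <= N)%N -> spec C (Witt i) = charser (length_factor i)) /\
  fps_map (spec C) (witt_prod Witt N) =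
    fps_map (spec C) sigma * (1 - gr (residual N)).
Proof.
set P := fps_map (spec C) sigma.
elim: N => [|N [IHW IH]].
  split=> [i|]; first by case: i.
  rewrite /witt_prod big_geq // rmorph1 -spec_lambda_neg -rmorphM.
  by rewrite mulVr ?lambda_neg_unit ?rmorph1.
have residual_small m : (m <= N)%N -> gr (residual N) m = 0.
  move=> lemN; rewrite graded_charser; apply: funext => w.
  rewrite /charser memNset // => -[/residual_size ltw /= szw].
  by move: ltw; rewrite szw ltnNge lemN.
have WN : spec C (Witt N.+1) = charser (length_factor N.+1).
  have : spec C (Witt N.+1) + fps_map (spec C) (witt_prod Witt N) N.+1 = P N.+1.
    rewrite /P /fps_map -((witt_identityP Witt).1 WittP) witt_prod_new.
    exact/esym/rmorphD.
  rewrite IH mulrBr mulr1 fpsDE fpsNE addrCA -[RHS]addr0.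
  move=> /addrI /eqP; rewrite subr_eq0 => /eqP ->.
  (* The residual series starts in degree [N.+1], so only the constant term
     of the series of all products of words of [C] meets it. *)
  rewrite fpsME big_ord_recl big1 => [|i _]; last first.
    by rewrite residual_small ?mulr0 // lift0 subSS leq_subr.
  by rewrite addr0 /P /fps_map sigma0 rmorph1 mul1r graded_charser.
split=> [i /andP[i_gt0]|].
  rewrite leq_eqVlt => /orP[/eqP->//|]; rewrite ltnS => leiN.
  by apply: IHW; rewrite i_gt0.
rewrite witt_prodS rmorphM rmorphV ?tmono_unit //= rmorphB rmorph1 /=.
rewrite fps_map_tmono IH -[X in tmono _ X]/(spec C (Witt N.+1)) WN.
by rewrite -mulrA graded_residual_step.
Qed.

Lemma spec_Witt i :
  (0 < i)%N -> spec C (Witt i) = charser (length_factor i).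
Proof. by move=> i_gt0; apply: (spec_Witt_prod i).1; rewrite i_gt0 leqnn. Qed.

(** * Comparison with the factorization of the free monoid over the code *)

Local Notation len := (fun c : C => size (val c)).

Lemma code_word_cat : {morph @code_word A C : u v / u ++ v}.
Proof. by move=> u v; rewrite /code_word map_cat flatten_cat. Qed.

Lemma code_word_inj : injective (@code_word A C).
Proof.
move=> u v /uC uv.
by apply: (inj_map val_inj); apply: uv => //; exact: all_map_val.
Qed.

Lemma size_code_word w : size (@code_word A C w) = weight len w.
Proof.
rewrite /weight; elim: w => [|c w IH]; first by rewrite big_nil.
by rewrite big_cons -IH -cat1s code_word_cat size_cat /code_word /= cats0.
Qed.

Lemma image_star (X : set (seq C)) :
  @code_word A C @` star X = star (@code_word A C @` X).
Proof.
have code_word_flatten (s : seq (seq C)) :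
    code_word (flatten s) = flatten (map (@code_word A C) s).
  by elim: s => //= w s IH; rewrite code_word_cat IH.
apply/seteqP; split=> [_ [_ [s Xs <-] <-]|_ [t Xt <-]].
  exists (map (@code_word A C) s) => //=; rewrite all_map; move: Xs.
  by apply: sub_all => w /set_mem Xw; apply: mem_set; exists w.
suff [s Xs st] : exists2 s, all (fun w => w \in X) s
                          & map (@code_word A C) s = t.
  by exists (flatten s); [exists s | rewrite code_word_flatten st].
elim: t Xt => [|v t IH] /=; first by exists [::].
case/andP=> /set_mem[w Xw <-] /IH[s Xs <-].
by exists (w :: s); rewrite //= mem_set.
Qed.

Lemma image_setcat (X Y : set (seq C)) :
  @code_word A C @` setcat X Y =
  setcat (@code_word A C @` X) (@code_word A C @` Y).
Proof.
apply/seteqP; split=> [_ [w [u [v [Xu Yv wE]]] <-]|w].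
  by rewrite wE; exists (code_word u), (code_word v); rewrite code_word_cat.
case=> u' [v' [[u Xu uE] [v Yv vE] ->]].
by exists (u ++ v); [exists u, v | rewrite code_word_cat uE vE].
Qed.

(** Injectivity of [code_word], i.e. unique factorization over [C], is what
    makes the image commute with differences. *)
Lemma image_code_wordD (X Y : set (seq C)) :
  @code_word A C @` (X `\` Y) = @code_word A C @` X `\` @code_word A C @` Y.
Proof.
apply/seteqP; split=> [_ [w [Xw nYw] <-]|_ [[w Xw <-] nYw]].
  by split; [exists w | case=> v Yv /code_word_inj vw; apply: nYw; rewrite -vw].
by exists w => //; split=> // Yw; apply: nYw; exists w.
Qed.

Lemma image_weight_part (X : set (seq C)) i :
  @code_word A C @` weight_part len X i = deg_part (@code_word A C @` X) i.
Proof.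
apply/seteqP; split=> [_ [w [Xw wi] <-]|_ [[w Xw <-] wi]].
  by split; [exists w | rewrite /= size_code_word].
by exists w => //; split=> //; rewrite /= -size_code_word.
Qed.

Lemma image_wfZ k : @code_word A C @` wfZ_from1 len k = residual k.
Proof.
elim: k => [|k IH] /=.
  apply/seteqP; split=> [_ [_ [c _ <-] <-]|w Cw].
    by rewrite /code_word /= cats0; apply: set_mem; exact: valP.
  exists [:: exist _ w (mem_set Cw) : C]; last exact: cats0.
  by exists (exist _ w (mem_set Cw)).
by rewrite image_setcat image_code_wordD image_star image_weight_part IH.
Qed.

Lemma image_wfD i : @code_word A C @` wfD len i = length_factor i.
Proof. by rewrite image_weight_part image_wfZ. Qed.

End LengthFactorization.

Lemma omit_empty_image (T U : Type) (f : T -> U) (s : nat -> set T) k :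
  omit_empty (fun i => f @` s i) k = omap (image^~ f) (omit_empty s k).
Proof.
(* Both sides are instances of one function of the nonemptiness test, so equal
   tests select the same index. *)
pose choose_kth V (r : nat -> set V) (p : pred nat) :=
  if pselect (exists i, [/\ (0 < i)%N, p i & count p (iota 1 i.-1) = k])
  is left e then Some (r (sval (cid e))) else None.
have same_nonempty : (fun i => `[< f @` s i !=set0 >]) =
    (fun i => `[< s i !=set0 >]).
  apply: funext => i; congr asbool; apply: propext.
  by split=> [[_ [x sx _]]|[x sx]]; [exists x | exists (f x); exists x].
rewrite -[LHS]/(choose_kth U (fun i => f @` s i) (fun i => `[< _ >])).
by rewrite same_nonempty /choose_kth /omit_empty; case: pselect.
Qed.

Theorem proposition1 (A : Type) (C : set (seq A)) (hC : is_code C) :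
  exists Q : nat -> set (seq A),
    (forall i : nat, (0 < i)%N ->
       is_code (Q i) /\ spec C (Witt i) = charser (Q i)) /\
    omit_empty Q = right_length_factorization C.
Proof.
have uC := is_code_unique_factorization hC.
exists (length_factor C); split=> [i i_gt0|].
  by split; [exact: length_factor_is_code | exact: spec_Witt].
have -> : length_factor C =
    fun i => @code_word A C @` wfD (fun c : C => size (val c)) i.
  by apply: funext => i; rewrite image_wfD.
by apply: funext => k; exact: omit_empty_image.
Qed.
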